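(* There exists a non-increasing function $\Gamma:(0,+\infty)\to(0,+\infty)$ with $\lim_{x\to0^+}\Gamma(x)=+\infty$ and $\lim_{x\to+\infty}\Gamma(x)=\gamma_c$, where $\gamma_c\simeq 1.082$, such that for every pair of positive parameters $(\beta,K)$ with $K>\Gamma(\beta)$ there exist constants $C=C(\beta,K)>0$ and $\Delta=\Delta(\beta,K)>0$ such that, for every even positive integer $N$, \[ \mathrm{Gap}(M_E)\le C e^{-\Delta N}, \] where $M_E$ is the Metropolis chain on $\{-1,0,1\}^N$ with stationary distribution $\pi_{\beta,K,N}$ and proposal chain $K_E$.
   Context: Spectral gap. For a reversible Markov chain $P$ on a finite set $\mathcal Y$ with eigenvalues $1=\lambda_0\ge\lambda_1\ge\dots\ge\lambda_{|\mathcal Y|-1}\ge -1$ (with multiplicity), $\mathrm{Gap}(P):=1-\max\{\lambda_1,|\lambda_{|\mathcal Y|-1}|\}$. Mean-field Blume–Emery–Griffiths model. $N$ is even, $\mathcal X=\{-1,0,1\}^N$, $S_N(x)=\sum_{i=1}^N x_i$, $R_N(x)=\sum_{i=1}^N x_i^2$, and for $\beta,K>0$ \[ \pi_{\beta,K,N}(x)=\frac{1}{Z_N(\beta,K)}\exp\Big\{-\beta R_N(x)+\frac{K\beta}{N}S_N^2(x)\Big\}, \] with $Z_N(\beta,K)$ the normalizing constant. Local proposal. $K_E(x,y)=\frac{1}{2N}\sum_{j=1}^N[\mathbb I_{\{x^{(+j)}\}}(y)+\mathbb I_{\{x^{(-j)}\}}(y)]$, where $x^{(\pm j)}=(x_1,\dots,x_j\pm1,\dots,x_N)$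 with the convention $2=-1$ and $-2=1$ in the $j$-th coordinate. Metropolis chain. With $\pi=\pi_{\beta,K,N}$, since $K_E$ is symmetric, $M_E(x,y)=K_E(x,y)\min(1,\pi(y)/\pi(x))$ for $x\ne y$ and $M_E(x,x)=1-\sum_{z\neq x}M_E(x,z)$; it is reversible with stationary distribution $\pi$. *)

(* Defs.v *)
From HB Require Import structures.
From mathcomp Require Import all_boot all_order all_algebra.
From mathcomp Require Import all_classical all_reals all_analysis.

Set Implicit Arguments.
Unset Strict Implicit.
Unset Printing Implicit Defensive.

Import Order.TTheory GRing.Theory Num.Theory.
Import numFieldNormedType.Exports.

Local Open Scope classical_set_scope.
Local Open Scope ring_scope.

Section SpectralGap.
Context {R : realType} {Y : finType}.
Implicit Type P : Y -> Y -> R.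

Definition transition_mx P : 'M[R]_#|Y| :=
  \matrix_(i, j) P (enum_val i) (enum_val j).

Definition is_spectrum P (s : seq R) : Prop :=
  sorted >=%R s /\
  char_poly (transition_mx P) = \prod_(l <- s) ('X - l%:P).

(* Such an s is unique, and it exists (with #|Y| entries) whenever P is
   reversible; the default value [::] is only taken if P does not have a real
   spectrum. *)
Definition spectrum P : seq R := xget [::] [set s | is_spectrum P s].

Definition gap P : R :=
  1 - Num.max (spectrum P)`_1 `|(spectrum P)`_(#|Y|.-1)|.

End SpectralGap.

Definition metropolis {R : realType} {Y : finType}
    (pi : Y -> R) (K : Y -> Y -> R) (x y : Y) : R :=
  let move z := K x z * Num.min 1 (pi z / pi x) in
  if y == x then 1 - \sum_(z | z != x) move z else move y.

(* The spin values -1, 0, 1 are represented by their residues mod 3, so that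
   the conventions 2 = -1 and -2 = 1 are the addition of 'Z_3. *)
Definition config (N : nat) := {ffun 'I_N -> 'Z_3}.

Section BlumeEmeryGriffiths.
Context {R : realType}.

Definition spin (s : 'Z_3) : R :=
  if s == 0 then 0 else if s == 1 then 1 else -1.

Section Config.
Context {N : nat}.
Implicit Types x y : config N.

Definition total_spin x : R := \sum_(i < N) spin (x i).

Definition total_square x : R := \sum_(i < N) spin (x i) ^+ 2.

Definition beg_weight (beta K : R) x : R :=
  expR (- beta * total_square x + K * beta / N%:R * total_spin x ^+ 2).

Definition beg_measure (beta K : R) x : R :=
  beg_weight beta K x / \sum_(z : config N) beg_weight beta K z.

Definition shift_at (j : 'I_N) (d : 'Z_3) x : config N :=
  [ffun i => if i == j then x i + d else x i].

Definition local_proposal x y : R :=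
  (2 * N%:R)^-1 *
  \sum_(j < N) ((y == shift_at j 1 x)%:R + (y == shift_at j (-1) x)%:R).

End Config.

Definition beg_metropolis (beta K : R) (N : nat) : config N -> config N -> R :=
  metropolis (beg_measure beta K) local_proposal.

End BlumeEmeryGriffiths.

(* Main.v *)
Require Import Defs.
From HB Require Import structures.
From mathcomp Require Import all_boot all_order all_algebra.
From mathcomp Require Import all_classical all_reals all_analysis.
From mathcomp Require Import complex ring lra.

Set Implicit Arguments.
Unset Strict Implicit.
Unset Printing Implicit Defensive.

Import Order.TTheory GRing.Theory Num.Theory.
Import numFieldNormedType.Exports.

Local Open Scope classical_set_scope.
Local Open Scope ring_scope.

(** The chain is slow because reversing the sign of the total spin S forces it
    through configurations with S close to 0, which carry little mass.

    A move changes one coordinate, hence S by at most 2, so two neighbours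
    whose total spins have different signs include one with |S| <= 1.  Such a
    configuration has weight at most exp (K beta), and there are only 3 ^ N
    configurations, so the flow between the signs is at most of order 3 ^ N
    (before normalization).  The configuration with all spins 1 alone has
    weight exp (beta (K - 1) N).  The ratio of the two is
    exp (- (beta (K - 1) - ln 3) N), which decays exponentially as soon as
    K > 1 + ln 3 / beta; so c + ln 3 / beta serves as threshold for
    every c >= 1, in particular for c close to 1.082.

    The ratio bounds the gap through the variational principle: if f is
    centred for the stationary weights, then 1 - lambda_1 is at most the
    Dirichlet form of f divided by its second moment ([gap_le_dirichlet]).
    The test function is the sign of S, which is centred by the symmetry
    x |-> - x; this symmetry replaces any estimate of the normalizing constant
    or of the mass of {S > 0} from above.

    Since [gap] is read off a factorization of the characteristic polynomial,
    the variational principle needs the spectral theorem.  Conjugating a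
    reversible P by the diagonal matrix of the square roots of the weights
    gives a real symmetric matrix with the same characteristic polynomial,
    diagonalized by a complex unitary matrix with real eigenvalues
    ([real_symmetric_diagonalization]). *)

(** * Spectral theory of real symmetric matrices *)

Lemma char_poly_intertwine (F : fieldType) n (A B P : 'M[F]_n) :
  P \in unitmx -> P *m A = B *m P -> char_poly A = char_poly B.
Proof.
move=> Pu PAB; have detP : \det (map_mx polyC P) != 0.
  by rewrite det_map_mx polyC_eq0 -unitfE -unitmxE.
apply: (mulfI detP); rewrite -det_mulmx [RHS]mulrC -det_mulmx.
by rewrite mulmxBr mulmxBl -!map_mxM PAB scalar_mxC.
Qed.

(** Over [R[i]] the matrix is normal, hence unitarily diagonalizable, and being
    hermitian it has real eigenvalues. *)
Lemma real_symmetric_diagonalization (R : rcfType) n (A : 'M[R]_n) :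
  A^T = A ->
  exists (d : 'I_n -> R) (U : 'M[R[i]]_n), U \is unitarymx /\
    U *m map_mx (real_complex R) A = diag_mx (\row_i (d i)%:C%C) *m U.
Proof.
move=> Asym; set AC := map_mx _ A.
have ACherm : AC \is hermsymmx.
  apply: realsym_hermsym.
    apply/is_hermitianmxP; rewrite expr0 scale1r.
    by apply/matrixP => i j; rewrite !mxE -{1}Asym mxE.
  by apply/mxOverP=> i j; rewrite mxE; apply/complex_realP; exists (A i j).
exists (fun i => complex.Re (spectral_diag AC 0 i)), (spectralmx AC).
split; first exact: spectral_unitarymx.
have /orthomx_spectralP/(congr1 (mulmx (spectralmx AC))) :=
  hermitian_normalmx ACherm.
rewrite -mulmxA mulKVmx ?spectral_unit// => ->; congr (diag_mx _ *m _).
apply/rowP => i; rewrite mxE RRe_real//.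
exact: (mxOverP (hermitian_spectral_diag_real ACherm)).
Qed.

Lemma char_poly_real_symmetric (R : rcfType) n (A : 'M[R]_n) d
    (U : 'M[R[i]]_n) : U \is unitarymx ->
    U *m map_mx (real_complex R) A = diag_mx (\row_i (d i)%:C%C) *m U ->
  char_poly A = \prod_(i < n) ('X - (d i)%:P).
Proof.
move=> Uu UA.
apply: (map_poly_inj (real_complex R)); rewrite map_char_poly.
rewrite (char_poly_intertwine (unitarymx_unit Uu) UA).
rewrite (char_poly_trig (diag_mx_is_trig _)) rmorph_prod.
apply: eq_bigr => i _.
by rewrite rmorphB /= map_polyX map_polyC /= !mxE eqxx.
Qed.

(** Let [m] bound the smaller of any two eigenvalues, as the second largest
    eigenvalue does.  If [u] is a fixed vector, one of its spectral coordinates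
    [j] is nonzero, so [d j = 1].  Either [1 <= m], or every other eigenvalue
    is at most [m < 1]; then [u] is concentrated at [j], a vector [v]
    orthogonal to [u] has no coordinate there, and its Rayleigh quotient only
    averages eigenvalues at most [m]. *)
Lemma rayleigh_le_second (R : rcfType) n (A : 'M[R]_n) (d : 'I_n -> R)
    (U : 'M[R[i]]_n) (m rho : R) (u v : 'rV[R]_n) :
  U \is unitarymx ->
  U *m map_mx (real_complex R) A = diag_mx (\row_i (d i)%:C%C) *m U ->
  (forall i j, i != j -> Num.min (d i) (d j) <= m) ->
  u *m A = u -> u != 0 -> u *m v^T = 0 -> v != 0 ->
  rho <= 1 -> rho * (v *m v^T) 0 0 <= (v *m A *m v^T) 0 0 ->
  rho <= m.
Proof.
move=> Uu UA dm uA u0 uv v0 rho1 rhov; have [m1|m1] := leP 1 m.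
  exact: le_trans m1.
pose D := diag_mx (\row_i (d i)%:C%C).
(* [hat x] is the row of coordinates of [x] in the eigenbasis. *)
pose hat (x : 'rV[R]_n) := map_mx (real_complex R) x *m U^t*%sesqui.
have UtU : U^t*%sesqui *m U = 1%:M.
  by rewrite -invmx_unitary// mulVmx// unitarymx_unit.
have AE : map_mx (real_complex R) A = U^t*%sesqui *m D *m U.
  by rewrite -mulmxA -UA mulmxA UtU mul1mx.
have hatA x : hat (x *m A) = hat x *m D.
  by rewrite /hat map_mxM AE !mulmxA mulmxtVK.
have realT (x : 'rV[R]_n) :
    (map_mx (real_complex R) x)^t*%sesqui = map_mx (real_complex R) x^T.
  apply/matrixP=> i j; rewrite !mxE conj_Creal//.
  by apply/complex_realP; exists (x j i).
have hatM x y : ((x *m y^T) 0 0)%:C%C = \sum_i hat x 0 i * (hat y 0 i)^*.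
  transitivity ((hat x *m (hat y)^t*%sesqui) 0 0).
    rewrite /hat trmx_mul map_mxM -/(U^t*%sesqui) trmxCK !mulmxA.
    by rewrite -[_ *m _ *m U]mulmxA UtU mulmx1 realT -map_mxM [RHS]mxE.
  by rewrite mxE; apply: eq_bigr => i _; rewrite !mxE.
have hat0 x : x != 0 -> exists i, hat x 0 i != 0.
  move=> x0; apply/rV0Pn; apply: contra_neq x0 => hx0.
  apply: (map_mx_inj (f := real_complex R)).
  have /(congr1 (mulmx^~ U)) := hx0.
  by rewrite /hat -mulmxA UtU mulmx1 mul0mx map_mx0.
have [j uj] := hat0 _ u0.
have du i : (d i)%:C%C * hat u 0 i = hat u 0 i.
  by rewrite -[in RHS]uA hatA mul_mx_diag !mxE mulrC.
have dj : d j = 1.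
  by apply: (@complexI R); apply: (mulIf uj); rewrite du rmorph1 mul1r.
have di i : i != j -> d i <= m.
  by move=> /dm; rewrite dj ge_min => /orP[//|]; rewrite leNgt m1.
have ui i : i != j -> hat u 0 i = 0.
  move=> ij; apply: contraTeq (di _ ij) => hu0; rewrite -ltNge.
  suff -> : d i = 1 by [].
  by apply: (@complexI R); apply: (mulIf hu0); rewrite du rmorph1 mul1r.
have vj : hat v 0 j = 0.
  have := hatM u v; rewrite uv mxE rmorph0 (bigD1 j)//= big1; last first.
    by move=> i /ui ->; rewrite mul0r.
  rewrite addr0 => /esym/eqP; rewrite mulf_eq0 (negPf uj)/= conjC_eq0.
  by move/eqP.
have vv : 0 < (v *m v^T) 0 0.
  rewrite -ltcR rmorph0 hatM lt_neqAle; apply/andP; split.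
    rewrite eq_sym psumr_eq0 => [|i _]; last exact: mul_conjC_ge0.
    have [i vi] := hat0 _ v0; apply/allPn; exists i.
      by rewrite mem_index_enum.
    by rewrite mul_conjC_eq0.
  by apply: sumr_ge0 => i _; exact: mul_conjC_ge0.
rewrite -(ler_pM2r vv); apply: le_trans rhov _.
rewrite -lecR rmorphM /= !hatM mulr_sumr; apply: ler_sum => i _.
have -> : hat (v *m A) 0 i = (d i)%:C%C * hat v 0 i.
  by rewrite hatA mul_mx_diag !mxE mulrC.
rewrite -mulrA.
have [->|/di dim] := eqVneq i j; first by rewrite vj !(mul0r, mulr0).
by rewrite ler_wpM2r ?mul_conjC_ge0// lecR.
Qed.

(** * The second eigenvalue and the variational bound on the gap *)

Section SecondEigenvalue.
Context {R : realType} {Y : finType}.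
Implicit Type P : Y -> Y -> R.

(** A polynomial determines the multiset of its roots, so any factorization of
    the characteristic polynomial describes [spectrum P]. *)
Lemma spectrum_perm P (d : 'I_#|Y| -> R) :
  char_poly (transition_mx P) = \prod_(i < #|Y|) ('X - (d i)%:P) ->
  sorted >=%R (spectrum P) /\ perm_eq (spectrum P) (map d (enum 'I_#|Y|)).
Proof.
move=> Pd; have [sP prodP] : is_spectrum P (spectrum P).
  apply: (xgetPex [::]); exists (sort >=%R (map d (enum 'I_#|Y|))); split.
    by apply: sort_sorted => x y; exact: le_total.
  rewrite (perm_big (map d (enum 'I_#|Y|))) /=; last by rewrite perm_sort.
  by rewrite big_map big_enum.
split=> //; apply: prod_XsubC_eq.
by rewrite -prodP Pd big_map big_enum.
Qed.

(** At most one entry of a nonincreasing sequence exceeds its entry of index 1,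
    so two distinct eigenvalues, counted with multiplicity, cannot both exceed
    it.  When there are fewer than two states the default entry [0] appears,
    but then there is no pair [i != j]. *)
Lemma min_le_second P (d : 'I_#|Y| -> R) :
  char_poly (transition_mx P) = \prod_(i < #|Y|) ('X - (d i)%:P) ->
  forall i j, i != j -> Num.min (d i) (d j) <= (spectrum P)`_1.
Proof.
move=> /spectrum_perm [sP pP] i j ij; set c := (spectrum P)`_1.
have count_le1 : (count (> c) (spectrum P) <= 1)%N.
  rewrite /c; case: (spectrum P) sP => [//|a [|b s]].
    by rewrite /=; case: (_ < _).
  move=> /= /andP[_ pbs]; rewrite ltxx add0n.
  rewrite (_ : count _ s = 0)%N ?addn0; first by case: (_ < _).
  apply/eqP; rewrite -leqn0 leqNgt -has_count; apply/hasPn => x xs.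
  have ge_trans : transitive (>=%R : rel R).
    by move=> ? ? ? /[swap]; exact: le_trans.
  by rewrite -leNgt; move/(order_path_min ge_trans)/allP : pbs; apply.
rewrite leNgt lt_min; apply/negP => /andP[ci cj].
move: count_le1; apply/negP; rewrite -ltnNge (permP pP) count_map.
rewrite -size_filter -[2%N]/(size [:: i; j]); apply: uniq_leq_size.
  by rewrite /= inE ij.
by move=> k; rewrite !inE mem_filter mem_enum andbT => /orP[]/eqP->.
Qed.

End SecondEigenvalue.

Section DirichletForm.
Context {R : realType} {Y : finType}.
Implicit Types (P : Y -> Y -> R) (w f : Y -> R).

(** The conductances [c] are kept abstract: a reversible [P] has
    [c x y = w x * P x y], and a Metropolis chain with proposal [K] has
    [c x y = K x y * Num.min (pi x) (pi y)]. *)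
Definition dirichlet (c : Y -> Y -> R) f : R :=
  2^-1 * \sum_x \sum_y c x y * (f x - f y) ^+ 2.

Lemma dirichletE P w f :
  (forall x y, w x * P x y = w y * P y x) -> (forall x, \sum_y P x y = 1) ->
  dirichlet (fun x y => w x * P x y) f =
  \sum_x w x * f x ^+ 2 - \sum_x \sum_y w x * P x y * f x * f y.
Proof.
move=> wP P1; rewrite /dirichlet.
have -> : \sum_x \sum_y w x * P x y * (f x - f y) ^+ 2 =
    \sum_x \sum_y w x * P x y * f x ^+ 2 +
    \sum_x \sum_y w x * P x y * f y ^+ 2 -
    2 * \sum_x \sum_y w x * P x y * f x * f y.
  rewrite mulr_sumr -big_split -sumrB; apply: eq_bigr => x _.
  rewrite mulr_sumr -big_split -sumrB; apply: eq_bigr => y _ /=.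
  by ring.
rewrite [X in _ + X - _]exchange_big /=.
rewrite (_ : \sum_x \sum_y w x * P x y * f x ^+ 2 =
    \sum_x w x * f x ^+ 2); last first.
  apply: eq_bigr => x _.
  by rewrite -mulr_suml -mulr_sumr P1 mulr1.
rewrite (_ : \sum_j \sum_i w i * P i j * f j ^+ 2 =
    \sum_x w x * f x ^+ 2); last first.
  apply: eq_bigr => x _.
  by under eq_bigr do rewrite wP; rewrite -mulr_suml -mulr_sumr P1 mulr1.
by field.
Qed.

Lemma big_enum_ord (F : Y -> R) : \sum_(i < #|Y|) F (enum_val i) = \sum_x F x.
Proof.
by rewrite [RHS](reindex (@enum_val Y predT)) //; exact/onW_bij/enum_val_bij.
Qed.

(** With [s = sqrt w], the matrix [s i * P i j / s j] is symmetric, and fixes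
    [s].  Its quadratic form at [s * f] is the second moment of [f] minus the
    Dirichlet form, and [s * f] is orthogonal to [s] when [f] is centred, so
    [rayleigh_le_second] bounds [lambda_1] from below.  The quotient is at most
    1, as required there, because the Dirichlet form is nonnegative; its
    diagonal terms vanish, so the diagonal of [P] may have any sign. *)
Lemma gap_le_dirichlet P w f :
  (forall x, 0 < w x) -> (forall x y, w x * P x y = w y * P y x) ->
  (forall x, \sum_y P x y = 1) -> (forall x y, x != y -> 0 <= P x y) ->
  \sum_x w x * f x = 0 ->
  gap P * \sum_x w x * f x ^+ 2 <= dirichlet (fun x y => w x * P x y) f.
Proof.
move=> w0 wP P1 P0 wf0; set V := \sum_x _.
have V0 : 0 <= V by apply: sumr_ge0 => x _; rewrite mulr_ge0 ?sqr_ge0// ltW.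
have E0 : 0 <= dirichlet (fun x y => w x * P x y) f.
  rewrite mulr_ge0// sumr_ge0// => x _; rewrite sumr_ge0// => y _.
  have [->|xy] := eqVneq x y; first by rewrite subrr expr0n mulr0.
  by apply: mulr_ge0 (sqr_ge0 _); apply: mulr_ge0 (P0 _ _ xy); exact: ltW.
have [V00|Vn0] := eqVneq V 0; first by rewrite V00 mulr0.
have {Vn0}V0 : 0 < V by rewrite lt_def Vn0.
pose s (i : 'I_#|Y|) := Num.sqrt (w (enum_val i)).
have s0 i : s i != 0 by rewrite lt0r_neq0// sqrtr_gt0.
have s2 i : s i * s i = w (enum_val i) by rewrite -expr2 sqr_sqrtr// ltW.
pose A := \matrix_(i, j) (s i * transition_mx P i j / s j).
have Asym : A^T = A.
  apply/matrixP => i j; rewrite !mxE; apply: (mulIf (s0 i)).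
  rewrite divfK// -[RHS]mulrA [_^-1 * _]mulrC mulrA.
  apply: (mulIf (s0 j)); rewrite divfK// mulrAC s2 -wP -s2.
  by ring.
have [d [U [Uu UA]]] := real_symmetric_diagonalization Asym.
have Pd : char_poly (transition_mx P) = \prod_(i < #|Y|) ('X - (d i)%:P).
  rewrite -(char_poly_real_symmetric Uu UA).
  apply: (@char_poly_intertwine _ _ _ _ (diag_mx (\row_i s i))).
    rewrite unitmxE det_diag unitfE; apply/prodf_neq0 => i _.
    by rewrite mxE s0.
  apply/matrixP => i j; rewrite mul_diag_mx mul_mx_diag !mxE.
  by rewrite divfK.
pose u : 'rV[R]_#|Y| := \row_i s i.
pose v : 'rV[R]_#|Y| := \row_i (s i * f (enum_val i)).
have uA : u *m A = u.
  apply/rowP => j; rewrite !mxE; under eq_bigr do rewrite !mxE !mulrA s2 wP.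
  rewrite -mulr_suml.
  rewrite (big_enum_ord (fun x => w (enum_val j) * P (enum_val j) x)).
  by rewrite -mulr_sumr P1 mulr1 -s2 mulfK.
have vv : (v *m v^T) 0 0 = V.
  rewrite mxE /V -(big_enum_ord (fun x => w x * f x ^+ 2)).
  by apply: eq_bigr => i _; rewrite !mxE -s2; ring.
have v0 : v != 0.
  by apply: contraTneq V0 => v0; rewrite -vv v0 mul0mx mxE ltxx.
have u0 : u != 0.
  by have [i _] := rV0Pn _ v0; apply/rV0Pn; exists i; rewrite mxE.
have uv : u *m v^T = 0.
  apply/matrixP => i j; rewrite !ord1 !mxE -[RHS]wf0.
  rewrite -(big_enum_ord (fun x => w x * f x)).
  by apply: eq_bigr => k _; rewrite !mxE mulrA s2.
have vAv : (v *m A *m v^T) 0 0 = V - dirichlet (fun x y => w x * P x y) f.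
  rewrite dirichletE// subKr exchange_big mxE.
  rewrite -(big_enum_ord (fun y => \sum_x w x * P x y * f x * f y)).
  apply: eq_bigr => j _; rewrite !mxE mulr_suml.
  rewrite -(big_enum_ord
    (fun x => w x * P x (enum_val j) * f x * f (enum_val j))).
  by apply: eq_bigr => i _; rewrite !mxE -s2; field.
have rho_le : 1 - dirichlet (fun x y => w x * P x y) f / V <= (spectrum P)`_1.
  apply: (rayleigh_le_second Uu UA (min_le_second Pd) uA u0 uv v0).
    by rewrite gerBl divr_ge0// ltW.
  by rewrite vv vAv mulrBl mul1r divfK// gt_eqF.
rewrite -ler_pdivlMr//; apply: (@le_trans _ _ (1 - (spectrum P)`_1)).
  by rewrite /gap lerD2l lerN2 le_max lexx.
by rewrite lerBlDr -lerBlDl.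
Qed.

End DirichletForm.

(** * Metropolis chains *)

Section Metropolis.
Context {R : realType} {Y : finType}.
Implicit Types (pi f : Y -> R) (K : Y -> Y -> R).

Lemma metropolis_sum1 pi K x : \sum_y metropolis pi K x y = 1.
Proof.
rewrite (bigD1 x)//= {1}/metropolis eqxx.
under [X in _ + X]eq_bigr => y yx do rewrite /metropolis (negPf yx).
by rewrite subrK.
Qed.

Lemma metropolis_flow pi K x y : 0 < pi x -> x != y ->
  pi x * metropolis pi K x y = K x y * Num.min (pi x) (pi y).
Proof.
move=> px xy; rewrite /metropolis eq_sym (negPf xy) mulrCA; congr (_ * _).
by rewrite minr_pMr ?ltW// mulr1 mulrC divfK// gt_eqF.
Qed.

(** Only ratios of weights enter the chain, so the partition function can be
    dropped. *)
Lemma metropolis_scale pi K c : c != 0 ->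
  metropolis (fun x => pi x / c) K = metropolis pi K.
Proof.
move=> c0; have ratioE x y : pi y / c / (pi x / c) = pi y / pi x.
  by rewrite invf_div mulrA divfK.
apply/funext => x; apply/funext => y; rewrite /metropolis ratioE.
by under eq_bigr do rewrite ratioE.
Qed.

Lemma gap_metropolis_le pi K f :
  (forall x, 0 < pi x) -> (forall x y, 0 <= K x y) ->
  (forall x y, K x y = K y x) -> \sum_x pi x * f x = 0 ->
  gap (metropolis pi K) * \sum_x pi x * f x ^+ 2 <=
  dirichlet (fun x y => K x y * Num.min (pi x) (pi y)) f.
Proof.
move=> pi0 K0 Ksym pif.
have -> : dirichlet (fun x y => K x y * Num.min (pi x) (pi y)) f =
    dirichlet (fun x y => pi x * metropolis pi K x y) f.
  congr (_ * _); apply: eq_bigr => x _; apply: eq_bigr => y _.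
  have [->|xy] := eqVneq x y; first by rewrite subrr expr0n !mulr0.
  by rewrite metropolis_flow.
apply: gap_le_dirichlet => //.
- move=> x y; have [->//|xy] := eqVneq x y.
  by rewrite !metropolis_flow// 1?eq_sym// Ksym minC.
- exact: metropolis_sum1.
- move=> x y xy; rewrite /metropolis eq_sym (negPf xy).
  by rewrite mulr_ge0// le_min ler01 divr_ge0// ltW.
Qed.

End Metropolis.

(** * Single-site moves *)

Section LocalMoves.
Context {R : realType} {N : nat}.
Implicit Types (x y : config N) (j : 'I_N) (d : 'Z_3).

Lemma spinN (s : 'Z_3) : spin (- s) = - spin s :> R.
Proof.
by case: s => [[|[|[|//]]]] ?; rewrite /spin /= ?oppr0 ?opprK.
Qed.

Lemma norm_spin_le1 (s : 'Z_3) : `|spin s : R| <= 1.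
Proof. by rewrite /spin; do 2?case: ifP; rewrite ?normrN ?normr1 ?normr0. Qed.

(** The wrap-around move from 1 to -1 is the extreme case. *)
Lemma total_spin_shift j d x :
  `|total_spin (shift_at j d x) - total_spin x : R| <= 2.
Proof.
rewrite -sumrB (bigD1 j)//= big1 ?addr0 => [|i ij]; last first.
  by rewrite ffunE (negPf ij) subrr.
by rewrite (le_trans (ler_normB _ _))// lerD ?norm_spin_le1.
Qed.

Lemma shift_atK j d : cancel (shift_at j d) (shift_at j (- d)).
Proof.
by move=> x; apply/ffunP => i; rewrite !ffunE; case: eqP; rewrite ?addrK.
Qed.

Lemma eq_shift_at j d x y : (y == shift_at j d x) = (x == shift_at j (- d) y).
Proof.
apply/eqP/eqP => ->; first by rewrite shift_atK.
by have := shift_atK j (- d) y; rewrite opprK => ->.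
Qed.

Lemma local_proposal_ge0 x y : 0 <= local_proposal x y :> R.
Proof.
by rewrite mulr_ge0 ?invr_ge0 ?mulr_ge0// sumr_ge0// => j _; rewrite addr_ge0.
Qed.

Lemma local_proposal_sym x y : local_proposal x y = local_proposal y x :> R.
Proof.
congr (_ * _); apply: eq_bigr => j _.
by rewrite addrC eq_shift_at opprK [in X in _ + X]eq_shift_at.
Qed.

Lemma local_proposal_sum1 x : (0 < N)%N -> \sum_y local_proposal x y = 1 :> R.
Proof.
move=> N0; rewrite -mulr_sumr exchange_big /= (eq_bigr (fun=> 2)) => [|j _].
  rewrite sumr_const card_ord -[2 *+ N]mulr_natr mulVf// mulf_neq0 ?pnatr_eq0//.
  by rewrite -lt0n.
have one z : \sum_y (y == z)%:R = 1 :> R.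
  by rewrite (bigD1 z)//= eqxx big1 ?addr0// => y /negPf ->.
by rewrite big_split /= !one.
Qed.

Lemma local_proposal_neighbour x y : local_proposal x y != 0 :> R ->
  `|total_spin y - total_spin x : R| <= 2.
Proof.
have [[j /orP[]/eqP->]|] :=
  pselect (exists j, (y == shift_at j 1 x) || (y == shift_at j (-1) x)).
- by move=> _; exact: total_spin_shift.
- by move=> _; exact: total_spin_shift.
move=> noj; rewrite /local_proposal big1 ?mulr0 ?eqxx// => j _.
have : ~~ ((y == shift_at j 1 x) || (y == shift_at j (-1) x)).
  by apply/negP => yj; apply: noj; exists j.
by rewrite negb_or => /andP[/negPf-> /negPf->]; rewrite addr0.
Qed.

End LocalMoves.

(** * The bottleneck at total spin zero *)

Section Bottleneck.
Context {R : realType} {N : nat} (beta K : R).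
Hypotheses (beta0 : 0 < beta) (K0 : 0 < K) (N0 : (0 < N)%N).
Implicit Types x y : config N.

Let w := beg_weight beta K (N := N).
Let f x : R := Num.sg (total_spin x).

Definition flip x : config N := [ffun i => - x i].

Lemma flipK : involutive flip.
Proof. by move=> x; apply/ffunP => i; rewrite !ffunE opprK. Qed.

Lemma total_spin_flip x : total_spin (flip x) = - total_spin x :> R.
Proof. by rewrite -sumrN; apply: eq_bigr => i _; rewrite ffunE spinN. Qed.

Lemma beg_weight_flip x : beg_weight beta K (flip x) = beg_weight beta K x.
Proof.
rewrite /beg_weight total_spin_flip sqrrN /total_square.
by under eq_bigr do rewrite ffunE spinN sqrrN.
Qed.

Lemma beg_weight_gt0 x : 0 < beg_weight beta K x.
Proof. exact: expR_gt0. Qed.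

Lemma sum_sg_total_spin : \sum_x w x * f x = 0.
Proof.
have : \sum_x w x * f x = - \sum_x w x * f x.
  rewrite {1}(reindex_inj (inv_inj flipK)) -sumrN; apply: eq_bigr => x _.
  by rewrite /w /f beg_weight_flip total_spin_flip sgrN mulrN.
by move=> h; lra.
Qed.

Lemma beg_weight_le x : `|total_spin x : R| <= 1 ->
  beg_weight beta K x <= expR (K * beta).
Proof.
move=> S1; rewrite ler_expR -[leRHS]add0r lerD//.
  rewrite mulNr oppr_le0 mulr_ge0 ?(ltW beta0)// sumr_ge0// => i _.
  exact: sqr_ge0.
have Kb0 : 0 <= K * beta by rewrite mulr_ge0// ltW.
have S2 : (total_spin x : R) ^+ 2 <= 1.
  by rewrite -(ger0_norm (sqr_ge0 _)) normrX expr_le1.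
rewrite -[leRHS]mulr1; apply: ler_pM; rewrite ?sqr_ge0 ?divr_ge0//.
by rewrite ler_pdivrMr ?ltr0n// ler_peMr// ler1n.
Qed.

(** If the signs differ, [|S x|] and [|S y|] add up to at most the distance 2
    of the total spins (or one of them vanishes), so one of them is at most 1
    and that configuration has small weight.  The factor 4 bounds the square of
    a difference of signs. *)
Lemma bottleneck x y : local_proposal x y != 0 :> R ->
  Num.min (w x) (w y) * (f x - f y) ^+ 2 <= 4 * expR (K * beta).
Proof.
move=> /local_proposal_neighbour xy; have [fxy|fxy] := eqVneq (f x) (f y).
  by rewrite fxy subrr expr0n mulr0 mulr_ge0// expR_ge0.
rewrite mulrC; apply: ler_pM; rewrite ?sqr_ge0//.
- by rewrite le_min !ltW ?beg_weight_gt0.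
- have sg1 z : `|f z| <= 1.
    by rewrite /f normr_sg lern1 leq_b1.
  have : `|f x - f y| <= 2 by rewrite (le_trans (ler_normB _ _))// lerD.
  move=> h; rewrite -(ger0_norm (sqr_ge0 _)) normrX.
  rewrite (_ : 4 = 2 ^+ 2); last by ring.
  by rewrite ler_pXn2r// nnegrE.
rewrite ge_min; apply/orP.
have [Sx|Sx] := leP `|total_spin x : R| 1; first by left; exact: beg_weight_le.
right; apply: beg_weight_le; move: xy Sx fxy; rewrite /f.
have [hx|hx|->] := ltgtP (total_spin x : R) 0; last by rewrite normr0 ltr10.
- rewrite (ltr0_sg hx) (ltr0_norm hx).
  have [hy|hy|->] := ltgtP (total_spin y : R) 0; last by rewrite normr0.
    by rewrite (ltr0_sg hy) eqxx.
  rewrite (gtr0_norm hy) ler_norml => /andP[h1 h2] h3 _; lra.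
- rewrite (gtr0_sg hx) (gtr0_norm hx).
  have [hy|hy|->] := ltgtP (total_spin y : R) 0; last by rewrite normr0.
    by rewrite (ltr0_norm hy) ler_norml => /andP[h1 h2] h3 _; lra.
  by rewrite (gtr0_sg hy) eqxx.
Qed.

Lemma beg_dirichlet_le :
  dirichlet (fun x y => local_proposal x y * Num.min (w x) (w y)) f <=
  2 * expR (K * beta) * 3 ^+ N.
Proof.
rewrite /dirichlet (_ : 2 * expR (K * beta) * 3 ^+ N =
    2^-1 * (3 ^+ N * (4 * expR (K * beta)))); last by field.
rewrite ler_pM2l ?invr_gt0//.
have -> : 3 ^+ N * (4 * expR (K * beta)) =
    \sum_(x : config N) \sum_y local_proposal x y * (4 * expR (K * beta)).
  under eq_bigr do rewrite -mulr_suml local_proposal_sum1// mul1r.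
  by rewrite sumr_const card_ffun !card_ord -[RHS]mulr_natl natrX.
apply: ler_sum => x _; apply: ler_sum => y _.
have [->|xy] := eqVneq (local_proposal x y : R) 0; first by rewrite !mul0r.
by rewrite -mulrA ler_wpM2l ?local_proposal_ge0// bottleneck.
Qed.

(** The single configuration with all spins 1 already has this weight. *)
Lemma beg_variance_ge : expR (beta * (K - 1) * N%:R) <= \sum_x w x * f x ^+ 2.
Proof.
pose x1 : config N := [ffun=> 1].
have Sx1 : total_spin x1 = N%:R :> R.
  rewrite /total_spin (eq_bigr (fun=> 1)) ?sumr_const ?card_ord// => i _.
  by rewrite ffunE.
have Rx1 : total_square x1 = N%:R :> R.
  rewrite /total_square (eq_bigr (fun=> 1)) ?sumr_const ?card_ord// => i _.
  by rewrite ffunE expr1n.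
have Nn0 : N%:R != 0 :> R by rewrite pnatr_eq0 -lt0n.
rewrite (bigD1 x1)//= {1}/w /beg_weight {1}/f Sx1 Rx1.
rewrite gtr0_sg ?ltr0n// expr1n mulr1.
rewrite (_ : - beta * _ + _ = beta * (K - 1) * N%:R); last by field.
rewrite lerDl sumr_ge0// => x _.
by rewrite mulr_ge0 ?sqr_ge0// ltW ?beg_weight_gt0.
Qed.

(** The rate compares the energy gained by aligning all the spins,
    [beta * (K - 1)] per site, with the largest possible entropy of the
    bottleneck, [ln 3] per site. *)
Lemma gap_beg_le : gap (beg_metropolis beta K (N := N)) <=
  2 * expR (K * beta) * expR (- (beta * (K - 1) - ln 3) * N%:R).
Proof.
have -> : beg_metropolis beta K (N := N) = metropolis w local_proposal.
  apply: metropolis_scale; rewrite gt_eqF//.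
  rewrite (bigD1 [ffun=> 0])//= ltr_wpDr ?beg_weight_gt0// sumr_ge0// => x _.
  by rewrite ltW ?beg_weight_gt0.
have gapV := gap_metropolis_le beg_weight_gt0 local_proposal_ge0
  local_proposal_sym sum_sg_total_spin.
have {gapV} gapE := le_trans gapV beg_dirichlet_le.
have bound : 2 * expR (K * beta) * expR (- (beta * (K - 1) - ln 3) * N%:R) *
    expR (beta * (K - 1) * N%:R) = 2 * expR (K * beta) * 3 ^+ N.
  rewrite -mulrA -expRD; congr (_ * _).
  rewrite -[in RHS](@lnK _ 3) ?posrE// -expRM_natl; congr expR; ring.
(* Below, the second moment is replaced by its lower bound, which is only
   legitimate for a positive gap. *)
have [g0|g0] := leP (gap (metropolis w local_proposal)) 0.
  by rewrite (le_trans g0)// !mulr_ge0 ?expR_ge0.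
rewrite -(ler_pM2r (expR_gt0 (beta * (K - 1) * N%:R))) bound.
by rewrite (le_trans _ gapE)// ler_pM2l// beg_variance_ge.
Qed.

End Bottleneck.

Theorem proposition6p1 (R : realType) :
  exists (gamma_c : R) (Gamma : R -> R),
    `|gamma_c - 1082 / 1000| < 5 / 10000 /\
    (forall x : R, 0 < x -> 0 < Gamma x) /\
    (forall x y : R, 0 < x -> x <= y -> Gamma y <= Gamma x) /\
    Gamma x @[x --> 0^'+] --> +oo /\
    Gamma x @[x --> +oo] --> gamma_c /\
    (forall beta K : R, 0 < beta -> 0 < K -> Gamma beta < K ->
      exists C Delta : R, 0 < C /\ 0 < Delta /\
        forall N : nat, (0 < N)%N -> ~~ odd N ->
          gap (beg_metropolis beta K (N := N)) <= C * expR (- Delta * N%:R)).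
Proof.
have l3 : 0 < ln 3 :> R by rewrite ln_gt0 ?ltr1n.
(* The number 1.082 is kept abstract: all that matters is that it exceeds 1. *)
have [c [c1 cE]] : exists c : R, 1 < c /\ `|c - 1082 / 1000| < 5 / 10000.
  exists (1082 / 1000); rewrite subrr normr0; split; lra.
exists c, (fun x => c + ln 3 / x); split=> //.
split; first by move=> x x0; rewrite addr_gt0 ?divr_gt0// (lt_trans _ c1).
split.
  move=> x y x0 xy; rewrite lerD2l ler_pM2l// lef_pV2// posrE//.
  exact: lt_le_trans xy.
split.
  apply/cvgryPge => A; near=> x.
  have x0 : 0 < x by near: x; exact: nbhs_right_gt.
  have xA : x <= ln 3 / (`|A| + 1).
    by near: x; apply: nbhs_right_le; rewrite divr_gt0// ltr_wpDl.
  rewrite (@le_trans _ _ (ln 3 / x))// ?lerDr ?(le_trans _ (ltW c1))//.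
  rewrite ler_pdivlMr// mulrC.
  apply: le_trans (ler_wpM2l (ltW x0) (ler_norm A)) _.
  move: xA; rewrite ler_pdivlMr ?ltr_wpDl// => /(le_trans _); apply.
  by rewrite ler_pM2l// lerDl.
split.
  rewrite -[X in _ --> X]addr0; apply: cvgD; first exact: cvg_cst.
  rewrite -(mulr0 (ln 3)); apply: cvgM; first exact: cvg_cst.
  by apply/gtr0_cvgV0; [exact: nbhs_pinfty_gt|exact: cvg_id].
move=> beta K beta0 K0 GK.
exists (2 * expR (K * beta)), (beta * (K - 1) - ln 3).
split; first by rewrite mulr_gt0 ?expR_gt0.
split=> [|N N0 _]; last exact: gap_beg_le.
rewrite subr_gt0; move: GK; rewrite -ltrBrDl ltr_pdivrMr// mulrC => h.
by apply: lt_trans h _; rewrite ltr_pM2l//; lra.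
Unshelve. all: by end_near.
Qed.
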